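(* Let $h,K,\tau,r,\lambda_r>0$, $c_2\ge 0$, and let the membership fee $F$ be fixed with potential premium market demand $c_1(F)>0$. Consider an e-tailer with no knowledge of Word-of-Mouth (WoM), whose premium customers respond to the maximum delivery time signal. That is, starting from a current premium demand rate $\lambda_p^0>0$, for each $k\ge 0$ the e-tailer chooses an optimal shipment policy $(t_1,t_2,t_3)$ of model [M1] (given in the context) with premium demand rate $\lambda_p=\lambda_p^k$, and the next premium demand rate is $$\lambda_p^{k+1}=c_1(F)\left(\frac{t_3}{\tau}\right)^{c_2}.$$ Let $\overline{\lambda_p}$ denote the long-term premium demand rate, i.e. the long-run behavior of the sequence $(\lambda_p^k)_{k\ge 0}$. Then: (i) If $c_1(F)\le \frac{2K}{h\tau^2}$, then the company captures the entire potential premium market, i.e. $\overline{\lambda_p}$ converges to $c_1(F)$. (ii) If $c_1(F)>\frac{2K}{h\tau^2}$ and $c_2\ge 2$, then $\overline{\lambda_p}$ cycles between $c_1(F)\left(\frac{2K}{c_1(F)h\tau^2}\right)^{c_2/2}$ and $c_1(F)$. (iii) If $c_1(F)>\frac{2K}{h\tau^2}$ and $c_2<2$, then $\overline{\lambda_p}$ converges linearly to $c_1(F)\left(\frac{2K}{c_1(F)h\tau^2}\right)^{\frac{c_2}{c_2+2}}$, and the constraint $t_3\le\tau$ on the maximum delivery time of regular orders becomes redundant thereafter.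
   Context: An e-tailer serves premium customers (demand rate $\lambda_p$) and regular customers (constant demand rate $\lambda_r$). A shipment cycle has three consecutive phases of lengths $t_1,t_2,t_3\ge 0$: in Phase 1 regular orders are served immediately from a local depot, in Phase 2 regular demand is lost, and in Phase 3 regular orders wait for the next shipment. Premium orders are always served immediately. Here $r$ is revenue per sale, $h$ is the unit holding cost per unit time, $K$ is the fixed shipment cost, and $\tau$ is the announced maximum delivery time for regular orders. Model [M1] (no knowledge of WoM; $\lambda_p,\lambda_r$ treated as given): maximize over $t_1,t_2,t_3$ $$r\lambda_p+\frac{r\lambda_r(t_1+t_3)}{t_1+t_2+t_3}-\frac{h\lambda_p(t_1+t_2+t_3)}{2}-\frac{h\lambda_r t_1^2}{2(t_1+t_2+t_3)}-\frac{K}{t_1+t_2+t_3}$$ subject to $t_3\le\tau$ and $t_1,t_2,t_3\ge 0$. No-operation solutions (those with $t_3=0$) are ignored. The maximum delivery time signal is $\theta^{MDT}=t_3/\tau\in[0,1]$. The premium customers' response function to a signal $\theta$ is $R(\theta)=c_1(F)\theta^{c_2}$, where $c_1(F)$ is the potential premium market demand at fee $F$ and $c_2$ is the premium customer sensitivity. Premium demand is updated to $R(\theta)$ after each shipment policy decision.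
   Formalization: In (ii) the starting rates for which the cycle is never reached are excluded: for c_2>2 the single fixed point c_1(F)(2K/(c_1(F)hτ²))^{c_2/(c_2+2)}, and for c_2=2 every rate strictly between 2K/(hτ²) and c_1(F). *)

(* Defs.v *)
From Stdlib Require Import Reals.
From Coquelicot Require Import Coquelicot.
Open Scope R_scope.

Record policy := Policy { t1 : R; t2 : R; t3 : R }.

Definition cycle_length (p : policy) : R := t1 p + t2 p + t3 p.

Definition m1_profit (r h K lambda_r lambda_p : R) (p : policy) : R :=
  r * lambda_p
  + r * lambda_r * (t1 p + t3 p) / cycle_length p
  - h * lambda_p * cycle_length p / 2
  - h * lambda_r * (t1 p) ^ 2 / (2 * cycle_length p)
  - K / cycle_length p.

(* No-operation solutions (t3 = 0) are not candidates. This also makes the cycle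
   length positive, so the quotients in [m1_profit] are genuine. *)
Definition operating (p : policy) : Prop := 0 <= t1 p /\ 0 <= t2 p /\ 0 < t3 p.

Definition m1_feasible (tau : R) (p : policy) : Prop :=
  operating p /\ t3 p <= tau.

Definition is_maximizer {A : Type} (f : A -> R) (S : A -> Prop) (x : A) : Prop :=
  S x /\ forall y, S y -> f y <= f x.

Definition m1_optimal (r h K tau lambda_r lambda_p : R) (p : policy) : Prop :=
  is_maximizer (m1_profit r h K lambda_r lambda_p) (m1_feasible tau) p.

(* Redundant: dropping t3 <= tau leaves the set of optimal policies unchanged. *)
Definition mdt_constraint_redundant (r h K tau lambda_r lambda_p : R) : Prop :=
  forall p : policy,
    m1_optimal r h K tau lambda_r lambda_p p <->
    is_maximizer (m1_profit r h K lambda_r lambda_p) operating p.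

Definition mdt_signal (tau : R) (p : policy) : R := t3 p / tau.

(* [Rpower] is the real power only for a positive base. Signals of operating
   policies are positive, so the junk value at 0 is never used. *)
Definition response (c1 : R -> R) (c2 F theta : R) : R :=
  c1 F * Rpower theta c2.

(* [lambda k] is the premium demand rate before the k-th shipment decision and
   [pol k] is any optimal policy for it; the premium customers then react. *)
Definition mdt_trajectory (r h K tau lambda_r : R) (c1 : R -> R) (c2 F : R)
    (lambda : nat -> R) (pol : nat -> policy) : Prop :=
  forall k : nat,
    m1_optimal r h K tau lambda_r (lambda k) (pol k) /\
    lambda (S k) = response c1 c2 F (mdt_signal tau (pol k)).

Definition eventually_cycles_between (u : nat -> R) (a b : R) : Prop :=
  exists N : nat, forall k : nat,
    u (N + 2 * k)%nat = a /\ u (N + 2 * k + 1)%nat = b.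

(* Q-linear convergence. The error bound is not a quotient because the limit can be
   reached exactly, for instance when c2 = 0. *)
Definition converges_linearly (u : nat -> R) (l : R) : Prop :=
  is_lim_seq u l /\
  exists (q : R) (N : nat), 0 < q < 1 /\
    forall k : nat, (N <= k)%nat -> Rabs (u (S k) - l) <= q * Rabs (u k - l).

(* Initial rates that, for c2 >= 2 and c1 F > 2K/(h tau^2), never reach the cycle
   between c1 F and c1 F * (2K/(c1 F h tau^2))^(c2/2). Where t3 <= tau is slack, the
   update is lambda |-> c1 F * (2K/(lambda h tau^2))^(c2/2). If c2 > 2 its repelling
   fixed point stays put. If c2 = 2 the update is an involution, so every rate
   strictly between 2K/(h tau^2) and c1 F stays on its own orbit of period at most 2. *)
Definition exceptional_start (h K tau : R) (c1 : R -> R) (c2 F lambda0 : R) : Prop :=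
  (2 < c2 /\
   lambda0 = c1 F * Rpower (2 * K / (c1 F * h * tau ^ 2)) (c2 / (c2 + 2))) \/
  (c2 = 2 /\ 2 * K / (h * tau ^ 2) < lambda0 < c1 F).

(* Main.v *)
(** Completing the square in the cycle length [T] writes the profit as a constant minus
    [(h lambda_p (T - S)^2 + 2 r lambda_r t2 + h lambda_r t1^2) / (2 T)], where
    [S = sqrt (2 K / (h lambda_p))] is the economic order interval. Hence every optimal
    policy has [t3 = min (tau, S)]. With [x = ln (lambda_p / c1 F)],
    [b = ln (2 K / (c1 F h tau^2))] and [d = c2 / 2], the demand update becomes the
    piecewise linear map [x |-> d * min (0, b - x)], whose slack branch is a reflected
    homothety of ratio [d] about [d b / (1 + d)]. *)
Require Import Defs.
From Stdlib Require Import Reals Lra Lia.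
From Coquelicot Require Import Coquelicot.
Open Scope R_scope.

(** * Profit deficit relative to the economic order interval *)

Definition m1_loss (r h lambda_r lambda_p S : R) (p : policy) : R :=
  h * lambda_p * (cycle_length p - S) ^ 2 + 2 * r * lambda_r * t2 p
  + h * lambda_r * t1 p ^ 2.

Lemma operating_cycle_length_pos (p : policy) : operating p -> 0 < cycle_length p.
Proof. unfold operating, cycle_length; lra. Qed.

(** Substituting [t1 + t3 = T - t2] and [K = h * lambda_p * S ^ 2 / 2] turns the terms in [T] and
    [1 / T] into a square around [S]. Giving [S] by its defining equation keeps the identity free of
    square roots. *)
Lemma m1_profit_loss (r h K lambda_r lambda_p S : R) (p : policy) :
  2 * K = h * lambda_p * S ^ 2 -> operating p ->
  m1_profit r h K lambda_r lambda_p p =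
  r * lambda_p + r * lambda_r - h * lambda_p * S
  - m1_loss r h lambda_r lambda_p S p / (2 * cycle_length p).
Proof.
  intros HK Hp.
  pose proof (operating_cycle_length_pos p Hp) as HT.
  replace K with (h * lambda_p * S ^ 2 / 2) by lra.
  unfold m1_profit, m1_loss.
  unfold cycle_length in *. field. lra.
Qed.

(** * Optimal policies at a fixed premium demand rate *)

Section OptimalPolicy.

Variables r h K tau lambda_r lambda_p S : R.
Hypotheses (Hr : 0 < r) (Hh : 0 < h) (Htau : 0 < tau) (Hlr : 0 < lambda_r)
  (Hlp : 0 < lambda_p) (HS : 0 < S) (HK : 2 * K = h * lambda_p * S ^ 2).

Let profit := m1_profit r h K lambda_r lambda_p.
Let loss := m1_loss r h lambda_r lambda_p S.

Lemma m1_loss_nonneg (p : policy) : operating p -> 0 <= loss p.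
Proof.
  intros (H1 & H2 & H3). unfold loss, m1_loss.
  pose proof (pow2_ge_0 (cycle_length p - S)).
  pose proof (pow2_ge_0 (t1 p)).
  assert (0 < h * lambda_p) by nra.
  assert (0 < h * lambda_r) by nra.
  assert (0 < r * lambda_r) by nra.
  nra.
Qed.

(** Three nonnegative terms with positive coefficients add up to at most zero, so each vanishes. *)
Lemma m1_loss_eq0 (p : policy) : operating p -> loss p <= 0 -> p = Policy 0 0 S.
Proof.
  intros (H1 & H2 & H3). unfold loss, m1_loss. intros Hle.
  pose proof (pow2_ge_0 (cycle_length p - S)) as HqT.
  pose proof (pow2_ge_0 (t1 p)) as Hq1.
  assert (A : 0 < h * lambda_p) by nra.
  assert (B : 0 < h * lambda_r) by nra.
  assert (C : 0 < r * lambda_r) by nra.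
  assert (P1 := Rmult_le_pos _ _ (Rlt_le _ _ A) HqT).
  assert (P2 := Rmult_le_pos _ _ (Rlt_le _ _ B) Hq1).
  assert (P3 := Rmult_le_pos _ _ (Rlt_le _ _ C) H2).
  assert (E2 : t2 p = 0) by (apply (Rmult_eq_reg_l (r * lambda_r)); lra).
  assert (E1 : (t1 p) ^ 2 = 0) by (apply (Rmult_eq_reg_l (h * lambda_r)); lra).
  assert (ET : (cycle_length p - S) ^ 2 = 0)
    by (apply (Rmult_eq_reg_l (h * lambda_p)); lra).
  assert (E1' : t1 p = 0) by nra.
  assert (ET' : cycle_length p = S) by nra.
  unfold cycle_length in ET'.
  destruct p as [u v w]; simpl in *.
  f_equal; lra.
Qed.

Lemma operating_interval : operating (Policy 0 0 S).
Proof. unfold operating; simpl; lra. Qed.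

Lemma m1_loss_interval : loss (Policy 0 0 S) = 0.
Proof. unfold loss, m1_loss, cycle_length; simpl; ring. Qed.

(** The constant part of the profit is common to both policies, which leaves the losses per unit
    time in reverse order. *)
Lemma m1_profit_le_loss (p q : policy) : operating p -> operating q ->
  profit q <= profit p ->
  loss p / cycle_length p <= loss q / cycle_length q.
Proof.
  intros Hp Hq. unfold profit.
  rewrite (m1_profit_loss _ _ _ _ _ S p) by assumption.
  rewrite (m1_profit_loss _ _ _ _ _ S q) by assumption.
  pose proof (operating_cycle_length_pos p Hp).
  pose proof (operating_cycle_length_pos q Hq).
  fold loss.
  replace (loss p / (2 * cycle_length p)) with (loss p / cycle_length p / 2)
    by (field; lra).
  replace (loss q / (2 * cycle_length q)) with (loss q / cycle_length q / 2)
    by (field; lra).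
  lra.
Qed.

Lemma m1_profit_max_interval (p : policy) :
  operating p -> profit p <= profit (Policy 0 0 S).
Proof.
  intros Hp. unfold profit.
  rewrite (m1_profit_loss _ _ _ _ _ S p) by assumption.
  rewrite (m1_profit_loss _ _ _ _ _ S (Policy 0 0 S))
    by (assumption || exact operating_interval).
  fold loss. rewrite m1_loss_interval.
  pose proof (operating_cycle_length_pos p Hp).
  pose proof (m1_loss_nonneg p Hp).
  assert (0 <= loss p / (2 * cycle_length p)) by (apply Rdiv_le_0_compat; lra).
  unfold Rdiv at 2. lra.
Qed.

Lemma m1_profit_ge_interval (p : policy) :
  operating p -> profit (Policy 0 0 S) <= profit p -> p = Policy 0 0 S.
Proof.
  intros Hp Hle. apply m1_loss_eq0; trivial.
  pose proof (m1_profit_le_loss p _ Hp operating_interval Hle) as H.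
  rewrite m1_loss_interval in H.
  pose proof (operating_cycle_length_pos p Hp) as HT.
  apply (Rmult_le_compat_r (cycle_length p)) in H; [|lra].
  unfold Rdiv in H. rewrite Rmult_assoc, Rinv_l in H; lra.
Qed.

Lemma m1_optimal_slack (p : policy) :
  S <= tau -> m1_optimal r h K tau lambda_r lambda_p p -> p = Policy 0 0 S.
Proof.
  intros Hle [[Hop _] Hmax]. apply m1_profit_ge_interval; trivial.
  apply Hmax. split; [exact operating_interval | exact Hle].
Qed.

(** With or without the constraint, [Policy 0 0 S] is the only maximizer. *)
Lemma mdt_redundant_slack :
  S <= tau -> mdt_constraint_redundant r h K tau lambda_r lambda_p.
Proof.
  intros Hle p; split.
  - intros Hp. rewrite (m1_optimal_slack p Hle Hp).
    split; [exact operating_interval | exact m1_profit_max_interval].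
  - intros [Hop Hmax].
    rewrite (m1_profit_ge_interval p Hop (Hmax _ operating_interval)).
    split.
    + split; [exact operating_interval | exact Hle].
    + intros q [Hq _]. exact (m1_profit_max_interval q Hq).
Qed.

(* Lengthening Phase 3 at the expense of the other phases at constant cycle length
   reduces the loss; if the cycle is shorter than [tau], the pure Phase 3 policy of
   length [tau] has a smaller loss per unit time. *)
Lemma m1_optimal_binding (p : policy) :
  tau <= S -> m1_optimal r h K tau lambda_r lambda_p p -> t3 p = tau.
Proof.
  intros Hle [[Hop Hfeas] Hmax].
  destruct (Rle_lt_or_eq_dec _ _ Hfeas) as [Hlt | E]; [exfalso | exact E].
  pose proof (operating_cycle_length_pos p Hop) as HT.
  destruct Hop as (H1 & H2 & H3).
  assert (A : 0 < h * lambda_p) by nra.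
  assert (B : 0 < h * lambda_r) by nra.
  assert (C : 0 < r * lambda_r) by nra.
  (* Optimality against competitors on the boundary [t3 = tau], cleared of denominators. *)
  assert (Hq : forall q, operating q -> t3 q = tau ->
    loss p * cycle_length q <= loss q * cycle_length p).
  { intros q Hopq E.
    assert (Hle' : profit q <= profit p).
    { apply Hmax. split; [exact Hopq | lra]. }
    apply m1_profit_le_loss in Hle'; [|unfold operating; lra | exact Hopq].
    pose proof (operating_cycle_length_pos q Hopq) as HTq.
    apply (Rmult_le_compat_r (cycle_length p * cycle_length q)) in Hle'; [|nra].
    replace (loss p / cycle_length p * (cycle_length p * cycle_length q))
      with (loss p * cycle_length q) in Hle' by (field; lra).
    replace (loss q / cycle_length q * (cycle_length p * cycle_length q))
      with (loss q * cycle_length p) in Hle' by (field; lra).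
    exact Hle'. }
  destruct (Rlt_or_le (cycle_length p) tau) as [HTt | HTt].
  - specialize (Hq (Policy 0 0 tau)).
    unfold operating, loss, m1_loss in Hq; simpl in Hq.
    assert (Hq' := Hq ltac:(lra) eq_refl). clear Hq.
    replace (cycle_length (Policy 0 0 tau)) with tau in Hq'
      by (unfold cycle_length; simpl; ring).
    set (T := cycle_length p) in *.
    assert (0 <= r * lambda_r * t2 p) by nra.
    assert (0 <= h * lambda_r * (t1 p * t1 p))
      by (apply Rmult_le_pos; nra).
    assert (h * lambda_p * ((T - S) * (T - S) * tau)
            <= h * lambda_p * ((tau - S) * (tau - S) * T)) by nra.
    assert ((T - S) * (T - S) * tau <= (tau - S) * (tau - S) * T)
      by (apply (Rmult_le_reg_l (h * lambda_p)); lra).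
    (* This product is the left side minus the right side of the previous inequality; it is positive
       because [T < tau <= S]. *)
    assert (0 < (tau - T) * (S * S - tau * T)) by (apply Rmult_lt_0_compat; nra).
    nra.
  (* At equal cycle length the square around [S] cancels, so only the terms in [t1] and [t2] are
     compared. *)
  - assert (Hsame : forall u v, 0 <= u -> 0 <= v -> u + v + tau = cycle_length p ->
      2 * (r * lambda_r * t2 p) + h * lambda_r * (t1 p * t1 p)
      <= 2 * (r * lambda_r * v) + h * lambda_r * (u * u)).
    { intros u v Hu Hv E.
      specialize (Hq (Policy u v tau)).
      assert (Hq' := Hq ltac:(unfold operating; simpl; lra) eq_refl). clear Hq.
      replace (cycle_length (Policy u v tau)) with (cycle_length p) in Hq'
        by (rewrite <- E; reflexivity).
      apply Rmult_le_reg_r in Hq'; [|exact HT].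
      unfold loss, m1_loss in Hq'.
      replace (cycle_length (Policy u v tau)) with (cycle_length p) in Hq'
        by (rewrite <- E; reflexivity).
      simpl in Hq'. lra. }
    (* The time given to Phase 3 is taken from [t2] alone if that suffices; otherwise [t2] drops to
       zero and [t1] to [T - tau], where [T] is the cycle length. *)
    destruct (Rle_or_lt (t1 p) (cycle_length p - tau)) as [Hc | Hc].
    + specialize (Hsame (t1 p) (cycle_length p - tau - t1 p)
        ltac:(lra) ltac:(lra) ltac:(lra)).
      assert (cycle_length p - tau - t1 p < t2 p) by (unfold cycle_length; lra).
      nra.
    + specialize (Hsame (cycle_length p - tau) 0 ltac:(lra) ltac:(lra) ltac:(lra)).
      set (u := cycle_length p - tau) in *.
      assert (0 <= r * lambda_r * t2 p) by nra.
      assert (0 <= u) by (unfold u; lra).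
      assert (u * u < t1 p * t1 p) by nra.
      nra.
Qed.

End OptimalPolicy.

(** * The threshold demand rate and the logarithm of the signal *)

Lemma economic_interval (h K lambda_p : R) :
  0 < h -> 0 < K -> 0 < lambda_p ->
  exists S, 0 < S /\ 2 * K = h * lambda_p * S ^ 2.
Proof.
  intros Hh HK Hl.
  assert (0 < h * lambda_p) by nra.
  exists (sqrt (2 * K / (h * lambda_p))). split.
  - apply sqrt_lt_R0, Rdiv_lt_0_compat; lra.
  - rewrite pow2_sqrt by (apply Rlt_le, Rdiv_lt_0_compat; lra). field. lra.
Qed.

(** The threshold is the demand rate whose economic order interval is exactly [tau]; squaring
    preserves order on positive lengths. *)
Lemma interval_le_tau (h K tau lambda_p S : R) :
  0 < h -> 0 < tau -> 0 < lambda_p -> 0 < S -> 2 * K = h * lambda_p * S ^ 2 ->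
  (S <= tau <-> 2 * K / (h * tau ^ 2) <= lambda_p).
Proof.
  intros Hh Ht Hl HS HK.
  assert (Hd : 0 < h * tau ^ 2) by (apply Rmult_lt_0_compat; [lra | apply pow_lt; lra]).
  assert (Hhl : 0 < h * lambda_p) by nra.
  rewrite HK. split; intros H.
  - apply (Rmult_le_reg_r (h * tau ^ 2)); [exact Hd|].
    unfold Rdiv. rewrite Rmult_assoc, Rinv_l, Rmult_1_r by lra.
    assert (S ^ 2 <= tau ^ 2) by (apply pow_incr; lra). nra.
  - apply (Rmult_le_compat_r (h * tau ^ 2)) in H; [|lra].
    unfold Rdiv in H. rewrite Rmult_assoc, Rinv_l, Rmult_1_r in H by lra.
    apply Rsqr_incr_0_var; [|lra].
    unfold Rsqr. apply (Rmult_le_reg_l (h * lambda_p)); nra.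
Qed.

Lemma mdt_redundant_of_le (r h K tau lambda_r lambda_p : R) :
  0 < r -> 0 < h -> 0 < K -> 0 < tau -> 0 < lambda_r -> 0 < lambda_p ->
  2 * K / (h * tau ^ 2) <= lambda_p ->
  mdt_constraint_redundant r h K tau lambda_r lambda_p.
Proof.
  intros Hr Hh HK Ht Hlr Hlp H.
  destruct (economic_interval h K lambda_p) as (S & HS & E); trivial.
  apply mdt_redundant_slack with S; trivial.
  apply (interval_le_tau h K tau lambda_p S); trivial.
Qed.

(** The signal is [min (1, S / tau)], and [(S / tau) ^ 2] is the threshold divided by [lambda_p],
    whence the factor one half. Only [t3] matters, so nothing about [t1] and [t2] is needed in the
    binding case. *)
Lemma ln_mdt_signal_optimal (r h K tau lambda_r lambda_p : R) (p : policy) :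
  0 < r -> 0 < h -> 0 < K -> 0 < tau -> 0 < lambda_r -> 0 < lambda_p ->
  m1_optimal r h K tau lambda_r lambda_p p ->
  ln (mdt_signal tau p) = Rmin 0 (ln (2 * K / (h * tau ^ 2)) - ln lambda_p) / 2.
Proof.
  intros Hr Hh HK Ht Hlr Hlp Hp.
  destruct (economic_interval h K lambda_p) as (S & HS & E); trivial.
  pose proof (interval_le_tau h K tau lambda_p S Hh Ht Hlp HS E) as Hiff.
  assert (Hd : 0 < h * tau ^ 2) by (apply Rmult_lt_0_compat; [lra | apply pow_lt; lra]).
  assert (Ha : 0 < 2 * K / (h * tau ^ 2)) by (apply Rdiv_lt_0_compat; lra).
  unfold mdt_signal.
  destruct (Rle_or_lt S tau) as [Hle | Hlt].
  - rewrite (m1_optimal_slack r h K tau lambda_r lambda_p S) with (p := p) by trivial.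
    simpl t3.
    assert (Hln : ln (2 * K / (h * tau ^ 2)) <= ln lambda_p) by (apply ln_le; tauto).
    rewrite Rmin_right by lra.
    assert (Hsq : 2 * K / (h * tau ^ 2) = lambda_p * (S / tau * (S / tau)))
      by (rewrite E; field; lra).
    assert (0 < S / tau) by (apply Rdiv_lt_0_compat; lra).
    rewrite Hsq, !ln_mult by (trivial; apply Rmult_lt_0_compat; trivial). field.
  - rewrite (m1_optimal_binding r h K tau lambda_r lambda_p S) with (p := p)
      by (trivial; lra).
    rewrite Rdiv_diag, ln_1 by lra.
    assert (lambda_p < 2 * K / (h * tau ^ 2)).
    { apply Rnot_le_lt. intros H. apply Hiff in H. lra. }
    assert (ln lambda_p < ln (2 * K / (h * tau ^ 2))) by (apply ln_increasing; trivial).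
    rewrite Rmin_left by lra. field.
Qed.

(** * Orbits of the piecewise linear map *)

Section ReflectedHomothety.

Variables (b d : R) (x : nat -> R).
Hypotheses (Hd : 0 <= d) (Hx : forall k, x (S k) = d * Rmin 0 (b - x k)).

Lemma step_binding (k : nat) : x k <= b -> x (S k) = 0.
Proof. intros H. rewrite Hx, Rmin_left by lra. ring. Qed.

Lemma step_slack (k : nat) : b <= x k -> x (S k) = d * (b - x k).
Proof. intros H. rewrite Hx, Rmin_right by lra. ring. Qed.

Lemma step_nonpos (k : nat) : x (S k) <= 0.
Proof. rewrite Hx. pose proof (Rmin_l 0 (b - x k)). nra. Qed.

Lemma step_slack_dist (k : nat) : b <= x k ->
  x (S k) - d * b / (1 + d) = - d * (x k - d * b / (1 + d)).
Proof. intros H. rewrite step_slack by trivial. field. lra. Qed.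

(** After one step the orbit is nonpositive, hence on the binding branch, which maps to 0. *)
Lemma step_saturated : 0 <= b -> forall k, x (S (S k)) = 0.
Proof. intros Hb k. apply step_binding. pose proof (step_nonpos k). lra. Qed.

(** The point 0 is slack and goes to [d * b]; since [d * b <= b], that point is binding and goes
    back to 0. From [x N <= b] the orbit reaches 0 at [N + 1] and [d * b] at [N + 2]. *)
Lemma two_cycle : b < 0 -> 1 <= d -> forall N : nat, x N <= b ->
  forall k, x (N + 2 + 2 * k)%nat = d * b /\ x (N + 2 + 2 * k + 1)%nat = 0.
Proof.
  intros Hb H1 N HN.
  assert (Hlow : forall n, x n = 0 -> x (S n) = d * b).
  { intros n E. rewrite step_slack by lra. rewrite E. ring. }
  assert (Hhigh : forall n, x n = d * b -> x (S n) = 0).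
  { intros n E. apply step_binding. rewrite E. nra. }
  induction k as [|k [_ IH]].
  - replace (N + 2 + 2 * 0)%nat with (S (S N)) by lia.
    replace (S (S N) + 1)%nat with (S (S (S N))) by lia.
    assert (E := Hlow _ (step_binding N HN)). split; [exact E | exact (Hhigh _ E)].
  - replace (N + 2 + 2 * S k)%nat with (S (N + 2 + 2 * k + 1)) by lia.
    replace (S (N + 2 + 2 * k + 1) + 1)%nat with (S (S (N + 2 + 2 * k + 1))) by lia.
    assert (E := Hlow _ IH). split; [exact E | exact (Hhigh _ E)].
Qed.

(** An orbit that stayed slack forever would move away from the fixed point by the factor [d > 1] at
    each step, yet from index 1 on it is confined to the bounded interval between [b] and 0. *)
Lemma repelling_escape : b < 0 -> 1 < d -> x 0%nat <> d * b / (1 + d) ->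
  exists N, x N <= b.
Proof.
  intros Hb H1 H0.
  destruct (Classical_Prop.classic (exists N, x N <= b)) as [H | Hno]; [exact H | exfalso].
  assert (Hall : forall k, b < x k).
  { intros k. apply Rnot_le_lt. intros Hk. apply Hno. exists k. exact Hk. }
  set (s := d * b / (1 + d)) in *.
  assert (Hs : b < s < 0).
  { unfold s. split.
    - apply (Rmult_lt_reg_r (1 + d)); [lra|].
      replace (d * b / (1 + d) * (1 + d)) with (d * b) by (field; lra). lra.
    - apply (Rmult_lt_reg_r (1 + d)); [lra|].
      replace (d * b / (1 + d) * (1 + d)) with (d * b) by (field; lra). nra. }
  assert (Hgrow : forall k, Rabs (x k - s) = d ^ k * Rabs (x 0%nat - s)).
  { induction k as [|k IH]; [simpl; ring|].
    unfold s at 1. rewrite step_slack_dist by (left; apply Hall). fold s.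
    rewrite Rabs_mult, Rabs_Ropp, (Rabs_pos_eq d), IH by lra. simpl. ring. }
  assert (Hpos : 0 < Rabs (x 0%nat - s)) by (apply Rabs_pos_lt; lra).
  (* Multiplied by the initial distance, this bound becomes [- b] plus that distance, more than the
     interval allows. *)
  destruct (Pow_x_infinity d ltac:(rewrite Rabs_pos_eq; lra)
              (- b / Rabs (x 0%nat - s) + 1)) as [N HN].
  (* The upper bound 0 is known only for successors, as [x 0] may be positive. *)
  specialize (HN (S N) ltac:(lia)).
  rewrite Rabs_pos_eq in HN by (apply pow_le; lra).
  specialize (Hgrow (S N)).
  assert (Rabs (x (S N) - s) < - b).
  { pose proof (Hall (S N)). pose proof (step_nonpos N). apply Rabs_def1; lra. }
  apply Rge_le in HN.
  apply (Rmult_le_compat_r (Rabs (x 0%nat - s))) in HN; [|lra].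
  rewrite <- Hgrow in HN.
  replace ((- b / Rabs (x 0%nat - s) + 1) * Rabs (x 0%nat - s))
    with (- b + Rabs (x 0%nat - s)) in HN by (field; lra).
  lra.
Qed.

(** The first step makes the orbit nonpositive, so the minimum in the second is at least [b]; as
    [b < 0], scaling by [d < 1] lifts it strictly above [b]. *)
Lemma attracting_slack : b < 0 -> d < 1 -> forall k, b < x (S (S k)).
Proof.
  intros Hb H1 k. rewrite (Hx (S k)).
  assert (b <= Rmin 0 (b - x (S k))).
  { apply Rmin_glb; [lra|]. pose proof (step_nonpos k). lra. }
  nra.
Qed.

(** From index 2 on every step is slack, so the error is geometric of ratio [- d]. *)
Lemma attracting_lim : b < 0 -> d < 1 -> is_lim_seq x (d * b / (1 + d)).
Proof.
  intros Hb H1. set (s := d * b / (1 + d)).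
  apply (is_lim_seq_incr_n _ 2).
  assert (Hdist : forall k, x (k + 2)%nat - s = (- d) ^ k * (x 2%nat - s)).
  { induction k as [|k IH]; [simpl; ring|].
    replace (S k + 2)%nat with (S (k + 2)) by lia.
    unfold s at 1. rewrite step_slack_dist.
    - fold s. rewrite IH. simpl. ring.
    - replace (k + 2)%nat with (S (S k)) by lia. left. apply attracting_slack; trivial. }
  apply is_lim_seq_ext with (fun k => (- d) ^ k * (x 2%nat - s) + s).
  - intros k. rewrite <- Hdist. ring.
  - replace (Finite s) with (Finite (0 * (x 2%nat - s) + s)) by (f_equal; ring).
    apply is_lim_seq_plus'; [|apply is_lim_seq_const].
    apply is_lim_seq_mult'; [|apply is_lim_seq_const].
    apply is_lim_seq_geom. rewrite Rabs_Ropp, Rabs_pos_eq; lra.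
Qed.

End ReflectedHomothety.

(** * From logarithmic errors to linear convergence of the rates *)

Lemma exp_increasing_le (u v : R) : u <= v -> exp u <= exp v.
Proof. intros [H | ->]; [left; apply exp_increasing, H | right; reflexivity]. Qed.

(* The ratio [d] of the logarithmic errors survives exponentiation up to an
   arbitrarily small increase, here to [(1 + d) / 2], once the error is small. *)
Lemma exp_reflected_contraction (d y : R) :
  0 <= d < 1 -> Rabs y <= (1 - d) / 4 ->
  Rabs (exp (- d * y) - 1) <= (1 + d) / 2 * Rabs (exp y - 1).
Proof.
  intros Hd Hy.
  pose proof (exp_ineq1_le y). pose proof (exp_ineq1_le (- d * y)).
  destruct (Rle_or_lt 0 y) as [Hy0 | Hy0].
  - rewrite (Rabs_pos_eq (exp y - 1)) by lra.
    assert (exp (- d * y) <= 1) by (rewrite <- exp_0; apply exp_increasing_le; nra).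
    rewrite Rabs_left1 by lra. nra.
  - rewrite Rabs_left in Hy by trivial.
    assert (exp y <= 1) by (rewrite <- exp_0; apply exp_increasing_le; lra).
    rewrite (Rabs_left1 (exp y - 1)) by lra.
    rewrite Rabs_pos_eq by nra.
    set (z := - y) in *.
    pose proof (exp_ineq1_le z) as Hz. pose proof (exp_ineq1_le (- (d * z))) as Hdz.
    assert (Ez : exp y * exp z = 1)
      by (rewrite <- exp_plus, <- exp_0; f_equal; unfold z; ring).
    assert (Edz : exp (- d * y) * exp (- (d * z)) = 1)
      by (rewrite <- exp_plus, <- exp_0; f_equal; unfold z; ring).
    assert (Hz0 : 0 < z) by (unfold z; lra).
    pose proof (exp_pos y). pose proof (exp_pos (- d * y)).
    (* Bounding the inverse exponentials below by [1 + t <= exp t] gives rational upper bounds for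
       the exponentials themselves. *)
    assert (Hup : exp (- d * y) * (1 - d * z) <= 1) by nra.
    assert (Hlo : exp y * (1 + z) <= 1) by nra.
    assert (Hdz1 : 0 < 1 - d * z) by nra.
    apply Rle_trans with (d * z / (1 - d * z)).
    { apply (Rmult_le_reg_r (1 - d * z)); [lra|].
      replace (d * z / (1 - d * z) * (1 - d * z)) with (d * z) by (field; lra). lra. }
    apply Rle_trans with ((1 + d) / 2 * (z / (1 + z))).
    { apply (Rmult_le_reg_r ((1 - d * z) * (1 + z))); [nra|].
      replace (d * z / (1 - d * z) * ((1 - d * z) * (1 + z)))
        with (z * (d * (1 + z))) by (field; lra).
      replace ((1 + d) / 2 * (z / (1 + z)) * ((1 - d * z) * (1 + z)))
        with (z * ((1 + d) / 2 * (1 - d * z))) by (field; lra).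
      apply Rmult_le_compat_l; [lra|].
      (* After clearing denominators the claim is [z * d * (3 + d) <= 1 - d]; it follows from
         [d * (3 + d) <= 4] and the hypothesis [z <= (1 - d) / 4]. *)
      assert (z * (d * (3 + d)) <= z * 4) by (apply Rmult_le_compat_l; nra).
      lra. }
    apply Rmult_le_compat_l; [lra|].
    apply (Rmult_le_reg_r (1 + z)); [lra|].
    replace (z / (1 + z) * (1 + z)) with z by (field; lra). lra.
Qed.

(** Each error is [c * exp s] times [exp (x k - s) - 1], so the common factor drops out and the
    preceding contraction applies once [x k] is close to [s]. *)
Lemma exp_converges_linearly (c s d : R) (x : nat -> R) (N : nat) :
  0 < c -> 0 <= d < 1 -> is_lim_seq x s ->
  (forall k, (N <= k)%nat -> x (S k) - s = - d * (x k - s)) ->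
  converges_linearly (fun k => c * exp (x k)) (c * exp s).
Proof.
  intros Hc Hd Hlim Hstep. split.
  - apply is_lim_seq_mult'; [apply is_lim_seq_const|].
    apply is_lim_seq_continuous; [|exact Hlim].
    apply derivable_continuous_pt, derivable_pt_exp.
  - apply is_lim_seq_spec in Hlim.
    assert (He : 0 < (1 - d) / 4) by lra.
    destruct (Hlim (mkposreal _ He)) as [M HM]. simpl in HM.
    (* This ratio is strictly positive even for [d = 0]. *)
    exists ((1 + d) / 2), (Nat.max N M). split; [lra|].
    intros k Hk.
    assert (E : forall n, c * exp (x n) - c * exp s
                          = c * exp s * (exp (x n - s) - 1)).
    { intros n. replace (x n) with (s + (x n - s)) at 1 by ring.
      rewrite exp_plus. ring. }
    assert (0 < c * exp s) by (apply Rmult_lt_0_compat; [lra | apply exp_pos]).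
    rewrite !E, !Rabs_mult, (Rabs_pos_eq c), (Rabs_pos_eq (exp s))
      by (lra || (left; apply exp_pos)).
    rewrite Hstep by lia.
    assert (H1 := exp_reflected_contraction d (x k - s) Hd
                    (Rlt_le _ _ (HM k ltac:(lia)))).
    nra.
Qed.

(** * Logarithmic coordinates and the three demand regimes *)

Theorem theorem1 :
  forall (h K tau r lambda_r : R) (c1 : R -> R) (c2 F : R)
         (lambda : nat -> R) (pol : nat -> policy),
    0 < h -> 0 < K -> 0 < tau -> 0 < r -> 0 < lambda_r ->
    0 <= c2 -> 0 < c1 F -> 0 < lambda 0%nat ->
    mdt_trajectory r h K tau lambda_r c1 c2 F lambda pol ->
    (c1 F <= 2 * K / (h * tau ^ 2) ->
       is_lim_seq lambda (c1 F)) /\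
    (c1 F > 2 * K / (h * tau ^ 2) -> c2 >= 2 ->
       ~ exceptional_start h K tau c1 c2 F (lambda 0%nat) ->
       eventually_cycles_between lambda
         (c1 F * Rpower (2 * K / (c1 F * h * tau ^ 2)) (c2 / 2))
         (c1 F)) /\
    (c1 F > 2 * K / (h * tau ^ 2) -> c2 < 2 ->
       converges_linearly lambda
         (c1 F * Rpower (2 * K / (c1 F * h * tau ^ 2)) (c2 / (c2 + 2))) /\
       exists N : nat, forall k : nat, (N <= k)%nat ->
         mdt_constraint_redundant r h K tau lambda_r (lambda k)).
Proof.
  intros h K tau r lr c1 c2 F lambda pol Hh HK Ht Hr Hlr Hc2 Hc Hl0 Htraj.
  unfold exceptional_start.
  assert (Hht : 0 < h * tau ^ 2)
    by (apply Rmult_lt_0_compat; [lra | apply pow_lt; lra]).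
  set (a := 2 * K / (h * tau ^ 2)).
  assert (Ha : 0 < a) by (apply Rdiv_lt_0_compat; lra).
  replace (2 * K / (c1 F * h * tau ^ 2)) with (a / c1 F)
    by (unfold a; field; lra).
  assert (Hpos : forall k, 0 < lambda k).
  { intros [|k]; [exact Hl0|]. rewrite (proj2 (Htraj k)).
    apply Rmult_lt_0_compat; [lra | apply exp_pos]. }
  set (b := ln (a / c1 F)). set (d := c2 / 2).
  set (x := fun k => ln (lambda k / c1 F)).
  assert (Hbln : b = ln a - ln (c1 F)) by (apply ln_div; trivial).
  assert (Hxln : forall k, x k = ln (lambda k) - ln (c1 F))
    by (intros k; apply ln_div; trivial).
  assert (Hlx : forall k, lambda k = c1 F * exp (x k)).
  { intros k. unfold x. rewrite exp_ln by (apply Rdiv_lt_0_compat; trivial).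
    field. lra. }
  assert (Hd : 0 <= d) by (unfold d; lra).
  assert (Hstep : forall k, x (S k) = d * Rmin 0 (b - x k)).
  { intros k. destruct (Htraj k) as [Hopt E].
    apply ln_mdt_signal_optimal in Hopt; trivial. fold a in Hopt.
    unfold x at 1. rewrite E. unfold response, Rpower.
    rewrite Hopt.
    replace (b - x k) with (ln a - ln (lambda k)) by (rewrite Hbln, Hxln; ring).
    match goal with |- ln (c1 F * exp ?e / c1 F) = _ =>
      replace (c1 F * exp e / c1 F) with (exp e) by (field; lra) end.
    rewrite ln_exp. unfold d. field. }
  assert (Hfix : Rpower (a / c1 F) (c2 / (c2 + 2)) = exp (d * b / (1 + d))).
  { unfold Rpower. f_equal. fold b. unfold d. field. lra. }
  assert (Hba : forall k, x k <= b <-> lambda k <= a).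
  { intros k. rewrite Hxln, Hbln. split; intros H.
    - apply Rnot_lt_le. intros Hlt. apply ln_increasing in Hlt; [lra | trivial].
    - apply ln_le in H; [lra | apply Hpos]. }
  assert (Hb : c1 F > a -> b < 0).
  { intros H. apply ln_increasing in H; [lra | trivial]. }
  split; [|split].
  - intros Hle.
    assert (Hb0 : 0 <= b) by (apply ln_le in Hle; lra).
    apply (is_lim_seq_incr_n _ 2).
    apply is_lim_seq_ext with (fun _ => c1 F); [|apply is_lim_seq_const].
    intros k. replace (k + 2)%nat with (S (S k)) by lia.
    rewrite Hlx, (step_saturated b d x Hd Hstep Hb0), exp_0. ring.
  - intros Hgt H2 Hex.
    assert (Hb' := Hb Hgt).
    assert (Hd1 : 1 <= d) by (unfold d; lra).
    assert (Hin : exists N, x N <= b).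
    { destruct (Req_dec c2 2) as [E2 | Hne].
      - destruct (Rle_or_lt (lambda 0%nat) a) as [Hle | Hlt].
        + exists 0%nat. apply Hba. exact Hle.
        + exists 1%nat.
          (* For [d = 1] the slack branch is [x |-> b - x]; a start at or above [c1 F] has
             [x 0 >= 0] and lands in the binding region after one step. *)
          assert (Hge : c1 F <= lambda 0%nat).
          { apply Rnot_lt_le. intros H. apply Hex. right. auto. }
          apply ln_le in Hge; trivial.
          assert (Hx0 : 0 <= x 0%nat) by (rewrite Hxln; lra).
          rewrite (step_slack b d x Hstep) by lra.
          replace d with 1 by (unfold d; lra). lra.
      - apply (repelling_escape b d x Hd Hstep Hb'); [unfold d; lra|].
        intros E. apply Hex. left. split; [lra|].
        rewrite Hfix, <- E. apply Hlx. }
    destruct Hin as [N HN].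
    exists (N + 2)%nat. intros k.
    destruct (two_cycle b d x Hstep Hb' Hd1 N HN k) as [E1 E2].
    rewrite !Hlx, E1, E2, exp_0. unfold Rpower. fold b d. split; ring.
  - intros Hgt H2.
    assert (Hb' := Hb Hgt).
    assert (Hd1 : d < 1) by (unfold d; lra).
    split.
    + rewrite Hfix.
      assert (Hconv : converges_linearly (fun k => c1 F * exp (x k))
                        (c1 F * exp (d * b / (1 + d)))).
      { apply exp_converges_linearly with d 2%nat; trivial; [lra | |].
        - apply (attracting_lim b d x Hd Hstep); trivial.
        - intros k Hk. apply (step_slack_dist b d x Hd Hstep).
          destruct k as [|[|k]]; try lia.
          left. apply (attracting_slack b d x Hd Hstep); trivial. }
      destruct Hconv as [Hlim (q & N & Hq & HN)]. split.
      * apply is_lim_seq_ext with (2 := Hlim). intros k. symmetry. apply Hlx.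
      * exists q, N. split; [exact Hq|]. intros k Hk. rewrite !Hlx. apply HN, Hk.
    (* From index 2 on the orbit stays above [b], which means that the demand rate exceeds the
       threshold. *)
    + exists 2%nat. intros [|[|k]] Hk; try lia.
      apply mdt_redundant_of_le; trivial. fold a.
      apply Rnot_lt_le. intros Hlt.
      pose proof (attracting_slack b d x Hd Hstep Hb' Hd1 k).
      assert (x (S (S k)) <= b) by (apply Hba; lra). lra.
Qed.
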